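(* Let $\rho\ge 0$ and let $\mathcal{G}^*$ be an optimal guessing strategy, i.e. one minimizing $\mathbb{E}[C_{\mathcal{G}}(X)^\rho]$ over all guessing strategies $\mathcal{G}$. Then $$\mathbb{E}[C_{\mathcal{G}^*}(X)^\rho]\le\exp\left\{\rho H_{\frac{1}{1+\rho}}(Y)\right\},$$ where $Y$ is the auxiliary random variable obtained from $X$ by splitting each $x$ into $\lceil c_x\rceil$ equiprobable values.
   Context: $X$ is a random variable on a finite set $\mathcal{X}=\{x_1,\dots,x_M\}$ with distribution $P_X$; each $x\in\mathcal{X}$ has a fixed real cost $c_x\ge1$. A guessing strategy is a bijection $\mathcal{G}:\mathcal{X}\to\{1,\dots,M\}$. The guessing cost is $C_{\mathcal{G}}(x)=\sum_{j=1}^{\mathcal{G}(x)}c_{\mathcal{G}^{-1}(j)}$, so $\mathbb{E}[C_{\mathcal{G}}(X)^\rho]=\sum_{i=1}^M P_X(\mathcal{G}^{-1}(i))\left[\sum_{j=1}^i c_{\mathcal{G}^{-1}(j)}\right]^\rho$. The random variable $Y$ takes values in a set $\{y_1,\dots,y_N\}$ with $N=\sum_{x\in\mathcal{X}}\lceil c_x\rceil$, and $P_Y(y_t)=P_X(x_i)/\lceil c_{x_i}\rceil$ whenever $\sum_{l=1}^{i-1}\lceil c_{x_l}\rceil<t\le\sum_{l=1}^{i}\lceil c_{x_l}\rceil$. The Rényi entropy of order $\alpha>0$, $\alpha\ne1$, is $H_\alpha(Y)=\frac{1}{1-\alpha}\ln\sum_y P_Y(y)^\alpha$; $H_1$ is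 the Shannon entropy (natural logarithm). *)

(* Defs.v *)
From mathcomp Require Import all_boot all_order all_algebra.
From mathcomp Require Import all_classical all_reals all_analysis.

Set Implicit Arguments.
Unset Strict Implicit.
Unset Printing Implicit Defensive.

Import Order.TTheory GRing.Theory Num.Theory.
Local Open Scope ring_scope.

Definition is_pmf (R : realType) (U : finType) (p : U -> R) : Prop :=
  (forall u, 0 <= p u) /\ \sum_(u : U) p u = 1.

(* Expectation of f(X) when X has distribution p. *)
Definition expect (R : realType) (U : finType) (p f : U -> R) : R :=
  \sum_(u : U) p u * f u.

(* [ln 0 = 0] in the library, so that 0 * ln 0 = 0 as usual. *)
Definition shannon_entropy (R : realType) (U : finType) (p : U -> R) : R :=
  - \sum_(u : U) p u * ln (p u).

(* For alpha > 0 the library has [0 `^ alpha = 0]: null atoms do not count. *)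
Definition renyi_entropy (R : realType) (U : finType) (alpha : R)
    (p : U -> R) : R :=
  if alpha == 1 then shannon_entropy p
  else (1 - alpha)^-1 * ln (\sum_(u : U) p u `^ alpha).

(* A bijection X -> {1, ..., M} bundled with its inverse; positions are
   numbered from 0, so [guess G z = j] means that z is the (j+1)-st guess. *)
Record guessing (X : finType) (M : nat) := Guessing {
  guess :> X -> 'I_M;
  guessV : 'I_M -> X;
  guessK : cancel guess guessV;
  guessVK : cancel guessV guess
}.

Definition guess_cost (R : realType) (X : finType) (M : nat) (c : X -> R)
    (G : guessing X M) (z : X) : R :=
  \sum_(j < M | (j <= G z)%N) c (guessV G j).

Definition cost_moment (R : realType) (X : finType) (M : nat) (p c : X -> R)
    (rho : R) (G : guessing X M) : R :=
  expect p (fun z => guess_cost c G z `^ rho).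

Definition optimal_guessing (R : realType) (X : finType) (M : nat)
    (p c : X -> R) (rho : R) (G : guessing X M) : Prop :=
  forall G' : guessing X M, cost_moment p c rho G <= cost_moment p c rho G'.

(* The ceiling as a natural number; only used at costs >= 1, where the
   absolute value is harmless. *)
Definition ceiln (R : realType) (r : R) : nat := `|Num.ceil r|%N.

Definition split_size (R : realType) (X : finType) (c : X -> R) : nat :=
  (\sum_(z : X) ceiln (c z))%N.

(* q is the distribution of Y on {y_1, ..., y_N}, where X = {x_1, ..., x_M}.
   Both enumerations start at 0 here, whence <= on the left and < on the
   right in the range of t. *)
Definition is_split (R : realType) (X : finType) (M : nat) (x : 'I_M -> X)
    (p c : X -> R) (q : 'I_(split_size c) -> R) : Prop :=
  forall (i : 'I_M) (t : 'I_(split_size c)),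
    (\sum_(l < M | (l < i)%N) ceiln (c (x l)) <= t)%N ->
    (t < \sum_(l < M | (l <= i)%N) ceiln (c (x l)))%N ->
    q t = p (x i) / (ceiln (c (x i)))%:R.

(* Main.v *)
Require Import Defs.
From mathcomp Require Import all_boot all_order all_algebra.
From mathcomp Require Import all_classical all_reals all_analysis.
From mathcomp Require Import ring.

Set Implicit Arguments.
Unset Strict Implicit.
Unset Printing Implicit Defensive.

Import Order.TTheory GRing.Theory Num.Theory.
Local Open Scope ring_scope.

(** Guess in decreasing order of [q z = PX z / n z], where [n z] is the ceiling
    of [c z].  Whatever is guessed no later than [z] has [q]-value at least
    [q z], so with [alpha = 1 / (1 + rho)] the cost of [z] is at most
    [\sum_w n w * (q w / q z) `^ alpha = S / q z `^ alpha], where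
    [S = \sum_t PY t `^ alpha].  Since [1 - alpha * rho = alpha], averaging the
    [rho]-th powers gives [S `^ (1 + rho)], the exponential of the Rényi
    entropy on the right-hand side. *)

Lemma exists_decreasing_guessing (R : realType) (X : finType) (M : nat)
    (x : 'I_M -> X) (f : X -> R) : bijective x ->
  exists G : guessing X M,
    forall i j : 'I_M, (i <= j)%N -> f (guessV G j) <= f (guessV G i).
Proof.
move=> x_bij; pose ge_f := [rel a b : X | f b <= f a].
pose s := sort ge_f (enum X).
have cardX : #|X| = M by rewrite -(bij_eq_card x_bij) card_ord.
have size_s : size s = M by rewrite size_sort -cardE.
have s_uniq : uniq s by rewrite sort_uniq enum_uniq.
have mem_s z : z \in s by rewrite mem_sort mem_enum.
have idx_lt z : (index z s < M)%N by rewrite -size_s index_mem.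
(* [X] may be empty, so the default of [nth] is built from the position [j] itself. *)
pose g z := Ordinal (idx_lt z); pose h (j : 'I_M) := nth (x j) s j.
have gK : cancel g h by move=> z; rewrite /h nth_index.
have hK : cancel h g.
  by move=> j; apply: val_inj; rewrite /= index_uniq ?size_s.
exists (Guessing gK hK) => i j le_ij /=.
have s_sorted : sorted ge_f s by apply: sort_sorted => a b; exact: le_total.
have ge_f_trans : transitive ge_f.
  by move=> b a d /= ab bd; exact: le_trans bd ab.
have ge_f_refl : reflexive ge_f by move=> a /=.
have := sorted_leq_nth ge_f_trans ge_f_refl (x i) s_sorted.
move=> /(_ i j); rewrite !inE size_s !ltn_ord => /(_ isT isT le_ij) /=.
by rewrite /h (set_nth_default (x j) (x i)) // size_s.
Qed.

(** Induction on the number of blocks: each new block appends an interval of length [n l] on which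
    [F] is constant. Taking [F] on [nat] lets the partial sums be cut without casts between
    ordinals. *)
Lemma sum_blocks (V : nmodType) (M : nat) (n : 'I_M -> nat) (v : 'I_M -> V)
    (F : nat -> V) :
  (forall (i : 'I_M) t, (\sum_(l < M | (l < i)%N) n l <= t)%N ->
     (t < \sum_(l < M | (l <= i)%N) n l)%N -> F t = v i) ->
  \sum_(t < \sum_(l < M) n l) F t = \sum_(l < M) v l *+ n l.
Proof.
move=> FE.
(* General in [W]: it serves for the block lengths in [nat] and for the sums in [V]. *)
have split_last (W : nmodType) (w : 'I_M -> W) (i : 'I_M) :
    \sum_(l < M | (l <= i)%N) w l = \sum_(l < M | (l < i)%N) w l + w i.
  rewrite (bigD1 i) //= addrC; congr (_ + _).
  by apply: eq_bigl => l; rewrite ltn_neqAle andbC.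
have partial k : (k <= M)%N ->
    \sum_(0 <= t < \sum_(l < M | (l < k)%N) n l) F t =
    \sum_(l < M | (l < k)%N) v l *+ n l.
  elim: k => [_|k IHk lt_kM].
    by rewrite [RHS]big_pred0 // big_geq // big_pred0.
  have := split_last _ n (Ordinal lt_kM).
  rewrite (split_last _ (fun l => v l *+ n l) (Ordinal lt_kM)) /= => nE.
  rewrite (@big_cat_nat _ _ _ (\sum_(l < M | (l < k)%N) n l)) //=; last first.
    by rewrite nE leq_addr.
  rewrite IHk ?(ltnW lt_kM) //; congr (_ + _).
  rewrite (eq_big_nat _ _ (F2 := fun=> v (Ordinal lt_kM))); last first.
    by move=> t /andP[le_t lt_t]; exact: FE.
  by rewrite sumr_const_nat nE addKn.
have all_lt : (fun l : 'I_M => (l < M)%N) =1 xpredT.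
  by move=> l; rewrite ltn_ord.
by have := partial M (leqnn M); rewrite !(eq_bigl _ _ all_lt) big_mkord.
Qed.

Lemma le_ceiln (R : realType) (r : R) : r <= (ceiln r)%:R.
Proof.
apply: le_trans (ceil_ge r) _.
by rewrite /ceiln natr_absz ler_int ler_norm.
Qed.

Lemma sum_split_powR (R : realType) (X : finType) (M : nat) (x : 'I_M -> X)
    (p c : X -> R) (q : 'I_(split_size c) -> R) (alpha : R) :
  bijective x -> is_split x p q ->
  \sum_t q t `^ alpha =
  \sum_z (ceiln (c z))%:R * (p z / (ceiln (c z))%:R) `^ alpha.
Proof.
move=> x_bij q_split.
have x_on : {on predT, bijective x} by exact: onW_bij.
have sizeE : split_size c = (\sum_(l < M) ceiln (c (x l)))%N.
  by rewrite /split_size (reindex x).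
(* Extend the summand by [0] to all of [nat], the form that [sum_blocks] expects. *)
pose F k := oapp (fun t => q t `^ alpha) 0 (insub k).
rewrite [RHS](reindex x) //=.
under [RHS]eq_bigr do rewrite mulr_natl.
rewrite -(sum_blocks (F := F)) => [|i t le_t lt_t].
  by rewrite -sizeE; apply: eq_bigr => t _; rewrite /F valK.
(* Each block ends within the whole range, so the default [0] is never met there. *)
have lt_tN : (t < split_size c)%N.
  apply: leq_trans lt_t _; rewrite sizeE.
  by rewrite [leqRHS](bigID (fun l : 'I_M => (l <= i)%N)) leq_addr.
by rewrite /F insubT /= (q_split i).
Qed.

Section DecreasingGuessing.
Variables (R : realType) (X : finType) (M : nat) (p c n : X -> R) (rho : R).
Variable G : guessing X M.
Hypotheses (p_ge0 : forall z, 0 <= p z) (c_ge0 : forall z, 0 <= c z).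
Hypotheses (n_gt0 : forall z, 0 < n z) (c_le_n : forall z, c z <= n z).
Hypothesis rho_ge0 : 0 <= rho.
Let q z := p z / n z.
Hypothesis G_decr :
  forall i j : 'I_M, (i <= j)%N -> q (guessV G j) <= q (guessV G i).
Let alpha := 1 / (1 + rho).
Let S := \sum_z n z * q z `^ alpha.

Let q_ge0 z : 0 <= q z. Proof. by rewrite divr_ge0 // ltW. Qed.

Let term_ge0 z : 0 <= n z * q z `^ alpha.
Proof. by rewrite mulr_ge0 ?powR_ge0 // ltW. Qed.

Let S_ge0 : 0 <= S. Proof. exact: sumr_ge0. Qed.

Let alpha_ge0 : 0 <= alpha.
Proof. by rewrite divr_ge0 // addr_ge0. Qed.

Lemma guess_cost_le z : q z `^ alpha * guess_cost c G z <= S.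
Proof.
have V_on : {on predT, bijective (guessV G)}.
  by apply: onW_bij; exists G; [exact: guessVK | exact: guessK].
rewrite /S (reindex (guessV G)) //= /guess_cost mulr_sumr.
rewrite [leRHS](bigID (fun j : 'I_M => (j <= G z)%N)) /=.
rewrite -[leLHS]addr0 lerD ?sumr_ge0 // ler_sum // => j le_j.
rewrite mulrC ler_pM ?powR_ge0 // ge0_ler_powR // ?nnegrE //.
by have := G_decr le_j; rewrite guessK.
Qed.

Lemma cost_moment_le : cost_moment p c rho G <= S `^ (1 + rho).
Proof.
have rho1_gt0 : 0 < 1 + rho by rewrite ltr_pwDl.
have -> : S `^ (1 + rho) = \sum_z n z * q z `^ alpha * S `^ rho.
  rewrite -mulr_suml -/S powRD ?powRr1 //.
  by rewrite (gt_eqF rho1_gt0).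
apply: ler_sum => z _.
(* Null atoms contribute nothing on the left; for the others [q z > 0], so exponents of [q z] may be
   added. *)
have [pz0|pz_neq0] := eqVneq (p z) 0.
  by rewrite pz0 mul0r mulr_ge0 ?powR_ge0.
have qz_gt0 : 0 < q z by rewrite divr_gt0 // lt_neqAle eq_sym pz_neq0 p_ge0.
have C_ge0 : 0 <= guess_cost c G z by exact: sumr_ge0.
have -> : p z = n z * q z by rewrite /q mulrCA divff ?mulr1 ?gt_eqF.
have qE : q z `^ alpha * (q z `^ alpha) `^ rho = q z.
  rewrite -powRrM -powRD; last by rewrite (gt_eqF qz_gt0) implybT.
  have -> : alpha + alpha * rho = 1 by rewrite /alpha; field; rewrite gt_eqF.
  by rewrite powRr1 // ltW.
rewrite -[leLHS]mulrA -[leRHS]mulrA ler_wpM2l //; first exact: ltW.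
rewrite -[X in X * _ <= _]qE -[leLHS]mulrA ler_wpM2l ?powR_ge0 //.
rewrite -powRM ?powR_ge0 // ge0_ler_powR ?guess_cost_le ?nnegrE //.
by rewrite mulr_ge0 ?powR_ge0.
Qed.

End DecreasingGuessing.

(** Equality holds unless [q] vanishes, when the left-hand side is [0] but the
    right-hand side is [1], because [ln 0 = 0]. *)
Lemma powR_le_expR_renyi (R : realType) (U : finType) (q : U -> R) (rho : R) :
  0 < rho ->
  (\sum_u q u `^ (1 / (1 + rho))) `^ (1 + rho) <=
  expR (rho * renyi_entropy (1 / (1 + rho)) q).
Proof.
move=> rho_gt0; have rho1_neq0 : 1 + rho != 0 by rewrite gt_eqF ?addr_gt0.
have alpha_sub : 1 - 1 / (1 + rho) = rho / (1 + rho) by field.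
have alpha_neq1 : (1 / (1 + rho) == 1) = false.
  apply/negbTE; rewrite eq_sym -subr_eq0 alpha_sub.
  by rewrite mulf_neq0 ?invr_eq0 // gt_eqF.
rewrite /renyi_entropy alpha_neq1 alpha_sub /powR.
case: eqP => _; first by rewrite (negbTE rho1_neq0) expR_ge0.
rewrite mulrA le_eqVlt; apply/orP; left; apply/eqP.
congr (expR (_ * _)); field.
by rewrite rho1_neq0 gt_eqF.
Qed.

Theorem theorem3p2 (R : realType) (X : finType) (M : nat) (x : 'I_M -> X)
    (x_bij : bijective x) (PX c : X -> R) (PX_pmf : is_pmf PX)
    (c_ge1 : forall z, 1 <= c z)
    (PY : 'I_(split_size c) -> R) (PY_split : is_split x PX PY)
    (rho : R) (rho_ge0 : 0 <= rho)
    (G : guessing X M) (G_opt : optimal_guessing PX c rho G) :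
  cost_moment PX c rho G <= expR (rho * renyi_entropy (1 / (1 + rho)) PY).
Proof.
have [PX_ge0 PX_sum1] := PX_pmf.
(* At [rho = 0] the order is [1] and the entropy is Shannon's, but its factor [rho] vanishes and
   both sides equal [1]. *)
have [->|rho_neq0] := eqVneq rho 0.
  rewrite mul0r expR0 -PX_sum1; apply: ler_sum => z _.
  by rewrite powRr0 mulr1.
have rho_gt0 : 0 < rho by rewrite lt_neqAle eq_sym rho_neq0.
pose n z : R := (ceiln (c z))%:R.
have c_ge0 z : 0 <= c z by exact: le_trans (c_ge1 z).
have n_gt0 z : 0 < n z.
  by apply: lt_le_trans (le_ceiln _); exact: lt_le_trans (c_ge1 z).
have [H H_decr] := exists_decreasing_guessing (fun z => PX z / n z) x_bij.
apply: le_trans (G_opt H) _.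
apply: le_trans (powR_le_expR_renyi PY rho_gt0).
rewrite (sum_split_powR _ x_bij PY_split).
have c_le_n z : c z <= n z by exact: le_ceiln.
exact: cost_moment_le PX_ge0 c_ge0 n_gt0 c_le_n rho_ge0 H_decr.
Qed.
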